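(* Let $(R,\delta)$ be an $m_1$-inverse loop with permutation $J_R:R\to R$ such that $J_R(\delta)=\delta$ and $J_R^{h_1}\in\mathrm{Aut}(R)$, and let $(S,\delta)$ be an $m_2$-inverse loop with permutation $J_S:S\to S$ such that $J_S(\delta)=\delta$ and $J_S^{h_2}\in\mathrm{Aut}(S)$ (with $m_1,m_2,h_1,h_2\in\mathbb{Z}$). Let $m\in\mathbb{Z}$ satisfy $m\equiv m_1\ (\mathrm{mod}\ h_1)$ and $m\equiv m_2\ (\mathrm{mod}\ h_2)$, and let $(Q,\delta)$ be an $m$-inverse loop with permutation $J_Q$ such that $(R,\delta)$ is an $m_1$-inverse subloop of $(Q,\delta)$ and $(S,\delta)$ is an $m_2$-inverse subloop of $(Q,\delta)$. Suppose that the multiplication in $Q$ yields a bijection $$\Theta:R\times S\to Q,\qquad (r,s)\mapsto rs,$$ that $$(rs)q=r(sq),\qquad q(rs)=(qr)s,$$ and that $$J_Q(rs)=J_S(s)J_R(r),\qquad J_Q(sr)=J_R(r)J_S(s)$$ for all $r\in R$, $s\in S$, $q\in Q$. Then $(R,S)$ is a matched pair of $m$-inverse loops, and $Q\cong R\bowtie S$ as quasigroups.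
   Context: A quasigroup is a set $Q$ with a binary multiplication such that for all $a,b\in Q$ there are unique $x,y\in Q$ with $ax=b$ and $ya=b$. A loop is a quasigroup with an identity element $\delta$. For $m\in\mathbb{Z}$, a loop $Q$ is an $m$-inverse loop with permutation $J:Q\to Q$ if $J$ is a bijection satisfying $xJ(x)=\delta$ and $J^m(xy)\,J^{m+1}(x)=J^m(y)$ for all $x,y\in Q$. $\mathrm{Aut}(Q)$ denotes the group of bijections $f:Q\to Q$ with $f(xy)=f(x)f(y)$. Isomorphism of quasigroups means a bijection preserving multiplication. Let $R$, $S$, $m$ be as in the statement. $(R,S)$ is called a matched pair of $m$-inverse loops if there are maps $\phi:S\times R\to R$ and $\psi:S\times R\to S$ such that for all $r,r'\in R$ and $s\in S$: \begin{align*} &\phi(\delta,r)=r,\quad \phi(s,\delta)=\delta,\qquad \psi(\delta,r)=\delta,\quad \psi(s,\delta)=s,\\ &\phi(s,\phi(J_S(s),r))=r,\\ &\psi\big(\psi(s,J_R^m(rr')),J_R^{m+1}(r)\big)=\psi(s,J_R^m(r')),\\ &\phi(s,J_R^m(rr'))\,\phi\big(\psi(s,J_R^m(rr')),J_R^{m+1}(r)\big)=\phi(s,J_R^m(r')),\\ &\psi\big(s,\phi(J_S(s),r)\big)\,\psi(J_S(s),r)=\delta. \end{align*} Then $R\bowtie S$ denotes the set $R\times S$ with the multiplication $(r,s)(r',s'):=\big(r\,\phi(s,r'),\,\psi(s,r')s'\big)$ defined by such $\phi$, $\psi$. The claim is that such $\phi,\psi$ exist for which $Q\cong R\bowtie S$.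 *)

(* Defs.v *)
From HB Require Import structures.
From mathcomp Require Import all_boot all_order all_algebra.

Set Implicit Arguments.
Unset Strict Implicit.
Unset Printing Implicit Defensive.

Local Open Scope group_scope.

Definition quasigroup_axiom (Q : magmaType) : Prop :=
  forall a b : Q, (exists! x, a * x = b) /\ (exists! y, y * a = b).

HB.mixin Record BaseUMagma_isLoop Q of BaseUMagma Q := {
  quasigroupP : quasigroup_axiom Q;
  loop_mul1g : left_id (1 : Q) *%g;
  loop_mulg1 : right_id (1 : Q) *%g
}.

(* umagmaType cannot serve as a base: it requires a choiceType carrier. *)
#[short(type="loopType")]
HB.structure Definition Loop := {Q of BaseUMagma Q & BaseUMagma_isLoop Q}.

Definition isomorphism (P Q : magmaType) (f : P -> Q) : Prop :=
  bijective f /\ {morph f : x y / x * y}.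

Definition automorphism (Q : magmaType) (f : Q -> Q) : Prop := isomorphism f.

Definition quasigroup_isomorphic (P Q : magmaType) : Prop :=
  [/\ quasigroup_axiom P, quasigroup_axiom Q
    & exists f : P -> Q, isomorphism f].

(* Bijections of a type onto itself, carrying their inverse so that negative
   powers are functions; {perm T} is only available on a finType. *)
Record bijection (T : Type) := Bijection {
  bij_fun :> T -> T;
  bij_inv : T -> T;
  bij_funK : cancel bij_fun bij_inv;
  bij_invK : cancel bij_inv bij_fun
}.

Definition bij_pow (T : Type) (J : bijection T) (m : int) : T -> T :=
  match m with
  | Posz n => iter n (bij_fun J)
  | Negz n => iter n.+1 (bij_inv J)
  end.

Notation "J ^[ m ]" := (bij_pow J m%R)
  (at level 2, left associativity, format "J ^[ m ]") : group_scope.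

Definition m_inverse (m : int) (Q : loopType) (J : bijection Q) : Prop :=
  (forall x : Q, x * J x = 1) /\
  (forall x y : Q, J^[m] (x * y) * J^[m + 1] x = J^[m] y).

(* i exhibits R as a subloop of Q: R is identified with its image i(R). *)
Definition subloop (R Q : loopType) (i : R -> Q) : Prop :=
  [/\ injective i, {morph i : x y / x * y} & i 1 = 1].

(* i exhibits (R, J) as an m-inverse subloop of Q.  If J_Q is a permutation of Q
   with x J_Q(x) = 1, then i \o J = J_Q \o i since a z = 1 has only one solution z. *)
Definition m_inverse_subloop (m : int) (R : loopType) (J : bijection R)
    (Q : loopType) (i : R -> Q) : Prop :=
  m_inverse m J /\ subloop i.

Record matched_pair_maps (m : int) (R S : loopType)
    (JR : bijection R) (JS : bijection S)
    (phi : S -> R -> R) (psi : S -> R -> S) : Prop := MatchedPairMaps {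
  phi1r : forall r, phi 1 r = r;
  phis1 : forall s, phi s 1 = 1;
  psi1r : forall r, psi 1 r = 1;
  psis1 : forall s, psi s 1 = s;
  phi_phiJ : forall s r, phi s (phi (JS s) r) = r;
  psi_psiJ : forall s r r',
    psi (psi s (JR^[m] (r * r'))) (JR^[m + 1] r) = psi s (JR^[m] r');
  phi_mulJ : forall s r r',
    phi s (JR^[m] (r * r')) * phi (psi s (JR^[m] (r * r'))) (JR^[m + 1] r)
    = phi s (JR^[m] r');
  psi_mulJ : forall s r, psi s (phi (JS s) r) * psi (JS s) r = 1
}.

Definition bowtie (R S : loopType) (phi : S -> R -> R) (psi : S -> R -> S) : Type :=
  (R * S)%type.

Definition bowtie_mul (R S : loopType) (phi : S -> R -> R) (psi : S -> R -> S)
    (x y : bowtie phi psi) : bowtie phi psi :=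
  (x.1 * phi x.2 y.1, psi x.2 y.1 * y.2).

HB.instance Definition _ (R S : loopType) (phi : S -> R -> R) (psi : S -> R -> S) :=
  hasMul.Build (bowtie phi psi) (@bowtie_mul R S phi psi).

(* Main.v *)
(** Uniqueness of factorizations [q = r s] defines [phi] and [psi] by
    [s r = phi(s,r) psi(s,r)], and the two associativity hypotheses turn the
    factorization map into an isomorphism onto the bowtie product.  Expanding
    [(rs) J(rs) = 1] gives [s (J(s) r) = r], which yields the two axioms of a
    matched pair that involve [J_S].  The two that involve [J_R] amount to
    [(s J^m(rr')) J^{m+1}(r) = s J^m(r')].  Powers of [J] alternately preserve
    and reverse the products [rs] and [sr].  If [J^m] reverses them, the identity
    is the [m]-inverse law for [r] and [r' J^{-m}(s)].  If [J^m] preserves them,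
    then [J^{3m+1}] reverses them; being an automorphism of every [m]-inverse
    loop, it forces [rs = sr], and the identity follows by associativity.  The
    subloop [R] is itself [m]-inverse, because [J_Q] restricts to [J_R]. *)

Require Import Defs.
From HB Require Import structures.
From mathcomp Require Import all_boot all_order all_algebra.

Local Open Scope group_scope.

Lemma loop_mulgI (Q : loopType) (a x y : Q) : a * x = a * y -> x = y.
Proof.
by case: (quasigroupP a (a * y)) => -[z [_ uz]] _ e; rewrite -(uz x e) -(uz y).
Qed.

Lemma loop_mulIg (Q : loopType) (a x y : Q) : x * a = y * a -> x = y.
Proof.
by case: (quasigroupP a (y * a)) => _ [z [_ uz]] e; rewrite -(uz x e) -(uz y).
Qed.

(** The bowtie type carries a bare multiplication; its division property is transported from [Q]
    this way. *)
Lemma isomorphism_quasigroup (P Q : magmaType) (f : P -> Q) :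
  isomorphism f -> quasigroup_axiom P -> quasigroup_axiom Q.
Proof.
case=> -[g fK gK] fM quasiP a b.
have [[x [ax ux]] [y [ya uy]]] := quasiP (g a) (g b).
split; [exists (f x) | exists (f y)]; split.
- by rewrite -[a]gK -fM ax gK.
- by move=> z az; rewrite (ux (g z)) ?gK //; apply: (can_inj fK); rewrite fM !gK.
- by rewrite -[a]gK -fM ya gK.
- by move=> z za; rewrite (uy (g z)) ?gK //; apply: (can_inj fK); rewrite fM !gK.
Qed.

Lemma bij_powS (T : Type) (J : bijection T) (k : int) (x : T) :
  J^[k + 1] x = J (J^[k] x).
Proof.
(* [Negz n] stands for -(n+1), so the successor of [Negz 0] is already nonnegative and needs its own
   case. *)
case: k => [n | [|n]].
- by rewrite -PoszD addn1.
- by rewrite /= bij_invK.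
- have -> : (Negz n.+1 + 1 = Negz n)%R.
    by rewrite !NegzE -[n.+2]addn1 PoszD GRing.opprD GRing.subrK.
  by rewrite /= bij_invK.
Qed.

Lemma bij_powC (T : Type) (J : bijection T) (k : int) (x : T) :
  J^[k] (J x) = J (J^[k] x).
Proof.
case: k => n /=; first by rewrite -iterSr.
by rewrite -iterS iterSr bij_funK bij_invK.
Qed.

Lemma bij_pow_surj (T : Type) (J : bijection T) (k : int) (y : T) :
  exists x, J^[k] x = y.
Proof.
case: k => n /=.
- elim: n y => [|n IHn] y; first by exists y.
  by have [x e] := IHn (bij_inv J y); exists x; rewrite iterS e bij_invK.
- elim: n y => [|n IHn] y; first by exists (J y); rewrite /= bij_funK.
  by have [x e] := IHn (J y); exists x; rewrite iterS e bij_funK.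
Qed.

Lemma bij_pow_intertwine (T U : Type) (J : bijection T) (K : bijection U)
    (i : T -> U) : (forall x, K (i x) = i (J x)) ->
  forall k x, K^[k] (i x) = i (J^[k] x).
Proof.
move=> KJ; have KJV x : bij_inv K (i x) = i (bij_inv J x).
  by rewrite -{1}[x](bij_invK J) -KJ bij_funK.
case=> n x; [elim: n => //= n -> // | elim: n => [|n IHn]].
- by rewrite /= KJV.
- by rewrite /= in IHn *; rewrite IHn KJV.
Qed.

Lemma m_inverse_morph (m : int) (Q : loopType) (J : bijection Q) :
  m_inverse m J ->
  {morph (fun x => J^[m] (J^[m] (J^[m] (J x)))) : x y / x * y}.
Proof.
(* The law sends [xy = z] to [J^m z J^{m+1} x = J^m y]; iterate three times. *)
case=> _ Jm.
have step (x y z : Q) : x * y = z -> J^[m] z * J (J^[m] x) = J^[m] y.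
  by move=> <-; rewrite -bij_powS Jm.
move=> x y; have := step _ _ _ (step _ _ _ (step x y _ erefl)).
by rewrite -!bij_powC => ->.
Qed.

(** Both orders of the factors are recorded because a reversing map turns either kind of product
    into the other. *)
Definition preserves_products {A B : Type} {Q : magmaType} (i : A -> Q)
    (j : B -> Q) (f : Q -> Q) (fA : A -> A) (fB : B -> B) : Prop :=
  forall a b, f (i a * j b) = i (fA a) * j (fB b) /\
              f (j b * i a) = j (fB b) * i (fA a).

Definition reverses_products {A B : Type} {Q : magmaType} (i : A -> Q)
    (j : B -> Q) (f : Q -> Q) (fA : A -> A) (fB : B -> B) : Prop :=
  forall a b, f (i a * j b) = j (fB b) * i (fA a) /\
              f (j b * i a) = i (fA a) * j (fB b).

Lemma iter_reverses_products (A B : Type) (Q : magmaType) (i : A -> Q)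
    (j : B -> Q) (f : Q -> Q) (fA : A -> A) (fB : B -> B) (n : nat) :
  reverses_products i j f fA fB ->
  preserves_products i j (iter n f) (iter n fA) (iter n fB) \/
  reverses_products i j (iter n f) (iter n fA) (iter n fB).
Proof.
move=> fr; elim: n => [|n [fn|fn]]; first by left.
- by right=> a b; rewrite !iterS !(proj1 (fn _ _)) !(proj2 (fn _ _)); apply: fr.
- left=> a b; rewrite !iterS !(proj1 (fn _ _)) !(proj2 (fn _ _)).
  by have [] := fr (iter n fA a) (iter n fB b).
Qed.

Lemma bij_pow_reverses_products (A B : Type) (Q : magmaType) (i : A -> Q)
    (j : B -> Q) (J : bijection Q) (JA : bijection A) (JB : bijection B)
    (k : int) :
  reverses_products i j J JA JB ->
  preserves_products i j J^[k] JA^[k] JB^[k] \/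
  reverses_products i j J^[k] JA^[k] JB^[k].
Proof.
move=> Jr; case: k => n; apply: iter_reverses_products => // a b.
(* Negative powers iterate the inverse of [J], which also reverses products: apply [Jr] to
   preimages. *)
have [e1 e2] := Jr (bij_inv JA a) (bij_inv JB b).
by rewrite !bij_invK in e1 e2; rewrite -e1 -e2 !bij_funK.
Qed.

Lemma m_inverse_commute (m : int) (R S Q : loopType) (JR : bijection R)
    (JS : bijection S) (JQ : bijection Q) (iR : R -> Q) (iS : S -> Q) :
  m_inverse m JQ ->
  (forall r, JQ (iR r) = iR (JR r)) -> (forall s, JQ (iS s) = iS (JS s)) ->
  reverses_products iR iS JQ JR JS ->
  preserves_products iR iS JQ^[m] JR^[m] JS^[m] ->
  forall r s, iR r * iS s = iS s * iR r.
Proof.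
move=> Q_inv JiR JiS Jr Jm r s.
(* The argument compares products of values of J^{3m+1}, so [r] and [s] must first be written as
   such values. *)
have surj (T : Type) (J : bijection T) (y : T) :
    exists x, J^[m] (J^[m] (J^[m] (J x))) = y.
  have [x1 e1] := bij_pow_surj _ J m y; have [x2 e2] := bij_pow_surj _ J m x1.
  have [x3 e3] := bij_pow_surj _ J m x2.
  by exists (bij_inv J x3); rewrite bij_invK e3 e2.
have [a <-] := surj _ JR r; have [b <-] := surj _ JS s.
have := m_inverse_morph _ _ _ Q_inv (iR a) (iS b); cbv beta.
rewrite JiR JiS !(bij_pow_intertwine _ _ _ _ _ JiR)
  !(bij_pow_intertwine _ _ _ _ _ JiS) => <-.
by rewrite (proj1 (Jr _ _)) !(proj2 (Jm _ _)).
Qed.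

Theorem proposition2p12
  (R S Q : loopType) (JR : bijection R) (JS : bijection S) (JQ : bijection Q)
  (m m1 m2 h1 h2 : int)
  (R_inv : m_inverse m1 JR) (JR1 : JR 1 = 1) (JR_aut : automorphism (JR^[h1]))
  (S_inv : m_inverse m2 JS) (JS1 : JS 1 = 1) (JS_aut : automorphism (JS^[h2]))
  (m_m1 : (m = m1 %[mod h1])%Z) (m_m2 : (m = m2 %[mod h2])%Z)
  (Q_inv : m_inverse m JQ)
  (iR : R -> Q) (iS : S -> Q)
  (R_sub : m_inverse_subloop m1 JR iR) (S_sub : m_inverse_subloop m2 JS iS)
  (Theta_bij : bijective (fun rs : R * S => iR rs.1 * iS rs.2))
  (mul_rs_q : forall r s q, (iR r * iS s) * q = iR r * (iS s * q))
  (mul_q_rs : forall r s q, q * (iR r * iS s) = (q * iR r) * iS s)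
  (JQ_rs : forall r s, JQ (iR r * iS s) = iS (JS s) * iR (JR r))
  (JQ_sr : forall r s, JQ (iS s * iR r) = iR (JR r) * iS (JS s)) :
  exists (phi : S -> R -> R) (psi : S -> R -> S),
    matched_pair_maps m JR JS phi psi /\
    quasigroup_isomorphic Q (bowtie phi psi).
Proof.
have [_ [_ iRM iR1]] := R_sub; have [_ [_ iSM iS1]] := S_sub.
have [T TK KT] := Theta_bij; rewrite /= in KT.
pose phi s r := (T (iS s * iR r)).1; pose psi s r := (T (iS s * iR r)).2.
have srE s r : iS s * iR r = iR (phi s r) * iS (psi s r) by rewrite KT.
have factor_inj a b c d : iR a * iS b = iR c * iS d -> a = c /\ b = d.
  by move=> e; have [] : (a, b) = (c, d) by apply: (can_inj TK).
have JiR r : JQ (iR r) = iR (JR r).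
  by have := JQ_rs r 1; rewrite JS1 iS1 loop_mulg1 loop_mul1g.
have JiS s : JQ (iS s) = iS (JS s).
  by have := JQ_rs 1 s; rewrite JR1 iR1 loop_mulg1 loop_mul1g.
have JmiR := bij_pow_intertwine _ _ _ _ _ JiR.
have JmiS := bij_pow_intertwine _ _ _ _ _ JiS.
have mulKS s r : iS s * (iS (JS s) * iR r) = iR r.
  (* For r' = J_R^{-1}(r), J_Q(r's) = J_S(s) r and J_Q(r') = r, so multiplying by r' on the left
     makes both sides 1. *)
  apply: (loop_mulgI _ (iR (bij_inv JR r))); rewrite -mul_rs_q.
  have := Q_inv.1 (iR (bij_inv JR r) * iS s); rewrite JQ_rs bij_invK => ->.
  by have := Q_inv.1 (iR (bij_inv JR r)); rewrite JiR bij_invK => ->.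
have mul_phi_psi s r b :
    (iS s * iR r) * iS b = iR (phi s r) * iS (psi s r * b).
  by rewrite srE mul_rs_q iSM.
have JQr : reverses_products iR iS JQ JR JS by move=> r s; split.
have mulJ s r r' : iS s * iR (JR^[m] (r * r')) * iR (JR^[m + 1] r) =
    iS s * iR (JR^[m] r').
  have JmR : iR (JR^[m] (r * r')) * iR (JR^[m + 1] r) = iR (JR^[m] r').
    by rewrite -!JmiR iRM Q_inv.2.
  have [Jp|Jr] := bij_pow_reverses_products _ _ _ _ _ _ _ _ m JQr.
    have RS_comm := m_inverse_commute _ _ _ _ _ _ _ _ _ Q_inv JiR JiS JQr Jp.
    (* Carry [s] to the right past both elements of [R], apply [JmR] to them, and carry [s] back. *)
    by rewrite -RS_comm mul_rs_q -RS_comm mul_q_rs JmR RS_comm.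
  have [b <-] := bij_pow_surj _ JS m s.
  have := Q_inv.2 (iR r) (iR r' * iS b).
  by rewrite mul_q_rs -iRM !(proj1 (Jr _ _)) JmiR.
have mulsrr s r r' : (iS s * iR r) * iR r' =
    iR (phi s r * phi (psi s r) r') * iS (psi (psi s r) r').
  by rewrite srE mul_rs_q srE mul_q_rs iRM.
(* The axioms now follow by comparing two factorizations of one element; here it is s (J_S(s) r) = r
   = r 1. *)
have phi_psi_inv s r :
    phi s (phi (JS s) r) = r /\ psi s (phi (JS s) r) * psi (JS s) r = 1.
  apply: factor_inj; rewrite -mul_phi_psi -mul_q_rs -srE mulKS.
  by rewrite iS1 loop_mulg1.
have phi_psi_mul s r r' :
    phi s (JR^[m] (r * r')) * phi (psi s (JR^[m] (r * r'))) (JR^[m + 1] r)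
      = phi s (JR^[m] r') /\
    psi (psi s (JR^[m] (r * r'))) (JR^[m + 1] r) = psi s (JR^[m] r').
  by apply: factor_inj; rewrite -mulsrr mulJ srE.
have phi_psi1r r : phi 1 r = r /\ psi 1 r = 1.
  by apply: factor_inj; rewrite -srE iS1 loop_mul1g loop_mulg1.
have phi_psis1 s : phi s 1 = 1 /\ psi s 1 = s.
  by apply: factor_inj; rewrite -srE iR1 loop_mul1g loop_mulg1.
exists phi, psi; split.
  split=> *; by [apply: (phi_psi1r _).1 | apply: (phi_psi1r _).2
    | apply: (phi_psis1 _).1 | apply: (phi_psis1 _).2
    | apply: (phi_psi_inv _ _).1 | apply: (phi_psi_inv _ _).2
    | apply: (phi_psi_mul _ _ _).1 | apply: (phi_psi_mul _ _ _).2].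
have T_iso : @isomorphism Q (bowtie phi psi) T.
  split; first by exists (fun rs => iR rs.1 * iS rs.2).
  (* With x = rs and y = r's', the product is r ((s r') s'), and s r' is then factored by [phi] and
     [psi]. *)
  move=> x y; apply: (can_inj TK); rewrite KT -{1}[x]KT -{1}[y]KT /=.
  by rewrite mul_rs_q mul_q_rs mul_phi_psi mul_q_rs iRM.
split; [exact: quasigroupP | | by exists T].
exact: isomorphism_quasigroup _ _ _ T_iso quasigroupP.
Qed.
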